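(* Let $P,Q\subseteq\mathbb{Z}^r$ be finite sets such that there is an invertible affine-linear transformation $\phi:\mathbb{Q}^r\to\mathbb{Q}^r$ with $\phi(P)=Q$. Then there is a constant $c=c_{P,Q}\in(0,1)$ such that $\mathsf{pdd}_Q(c\alpha)\le\mathsf{pdd}_P(\alpha)$ for all $0<\alpha<1$.
   Context: Let $[N]=\{1,\dots,N\}$. For a finite $P\subseteq\mathbb{Z}^r$ and $0<\alpha<1$, the popular difference density $\mathsf{pdd}_P(\alpha)$ is the largest real number such that for every $\epsilon>0$ there exists $N_0=N_0(P,\epsilon)$ such that for every $N\ge N_0$ and every $A\subseteq[N]^r$ with $|A|\ge\alpha N^r$ there is some nonzero integer $d$ with $|\{x\in\mathbb{Z}^r : x+dy\in A \text{ for all } y\in P\}|\ge(\mathsf{pdd}_P(\alpha)-\epsilon)N^r$. *)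

(* Defs.v *)
From HB Require Import structures.
From mathcomp Require Import all_boot all_order all_algebra finmap.
From mathcomp Require Import lra.
From mathcomp Require Import all_classical all_reals all_analysis.

Set Implicit Arguments.
Unset Strict Implicit.
Unset Printing Implicit Defensive.

Import Order.TTheory GRing.Theory Num.Theory.

Local Open Scope classical_set_scope.
Local Open Scope ring_scope.

Definition in_box (r N : nat) (x : 'rV[int]_r) : Prop :=
  forall i, (1 <= x 0 i)%R /\ (x 0 i <= N%:Z)%R.

Definition copies (r : nat) (P A : {fset 'rV[int]_r}) (d : int) :
    set 'rV[int]_r :=
  [set x | forall y, y \in P -> x + d *: y \in A].

(* [counting] is the cardinality with values in [\bar R], equal to +oo on
   infinite sets; [copies P A d] is infinite only when P is empty and r > 0. *)
Definition popular (R : realType) (r : nat) (P : {fset 'rV[int]_r})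
    (alpha : R) : set R :=
  [set b | forall eps : R, 0 < eps -> exists N0 : nat, forall N : nat,
     (N0 <= N)%N -> forall A : {fset 'rV[int]_r},
     (forall x, x \in A -> in_box N x) ->
     alpha * N%:R ^+ r <= #|` A|%:R ->
     exists2 d : int, d != 0 &
       (((b - eps) * N%:R ^+ r)%:E <= counting (copies P A d))%E].

(* The largest element of [popular P alpha]. It exists as soon as P is nonempty
   and alpha <= 1 (lemma [pddP]); the default value 0 is reached only outside
   this case. *)
Definition pdd (R : realType) (r : nat) (P : {fset 'rV[int]_r})
    (alpha : R) : R :=
  xget 0 [set b | popular P alpha b /\ ubound (popular P alpha) b].

Definition rat_vec (r : nat) (x : 'rV[int]_r) : 'rV[rat]_r :=
  map_mx (fun k : int => k%:~R) x.

Definition invertible_affine (r : nat) (phi : 'rV[rat]_r -> 'rV[rat]_r) : Prop :=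
  exists M : 'M[rat]_r, exists b : 'rV[rat]_r,
    M \in unitmx /\ forall x, phi x = x *m M + b.

Lemma copies_le (R : realType) (r : nat) (P A : {fset 'rV[int]_r}) (d : int) :
  P != fset0 -> (counting (copies P A d) <= (#|` A|%:R : R)%:E)%E.
Proof.
case/fset0Pn => y yP.
have inj : injective (fun x : 'rV[int]_r => x - d *: y).
  by move=> u v; exact: addIr.
pose B := [fset (x - d *: y) | x in A]%fset.
have sub : copies P A d `<=` [set` B].
  move=> x /(_ y yP) xA; apply/imfsetP; exists (x + d *: y) => //=.
  by rewrite addrK.
have fin : finite_set (copies P A d).
  exact: sub_finite_set sub (finite_fset B).
rewrite /counting asboolT// lee_fin ler_nat.
have <- : #|` B| = #|` A| by rewrite card_imfset.
by apply/fsubset_leq_card/fsubsetP => x; rewrite in_fset_set// inE => /sub.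
Qed.

Lemma box_ex (r N : nat) : exists2 A : {fset 'rV[int]_r},
  (forall x, x \in A -> in_box N x) & #|` A| = (N ^ r)%N.
Proof.
pose f (m : 'rV['I_N]_r) : 'rV[int]_r := map_mx (fun k : 'I_N => k.+1%:Z) m.
have inj : injective f.
  move=> m n /matrixP fmn; apply/matrixP => i j.
  by have := fmn i j; rewrite !mxE => -[] /val_inj.
exists [fset f m | m : 'rV['I_N]_r]%fset.
  move=> x /imfsetP[m _ ->] i; rewrite mxE; split=> //.
  by rewrite lez_nat ltn_ord.
by rewrite card_imfset//= -cardE card_mx card_ord mul1n.
Qed.

Lemma pddP (R : realType) (r : nat) (P : {fset 'rV[int]_r}) (alpha : R) :
  P != fset0 -> alpha <= 1 ->
  popular P alpha (pdd P alpha) /\ ubound (popular P alpha) (pdd P alpha).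
Proof.
move=> P0 alpha1; set S := popular P alpha.
have S0 : S 0.
  move=> eps eps0; exists 0%N => N _ A _ _; exists 1 => //.
  apply: (@le_trans _ _ 0%E).
    by rewrite lee_fin mulr_le0_ge0 ?exprn_ge0// sub0r oppr_le0 ltW.
  by rewrite /counting; case: ifPn; rewrite ?lee_fin ?leey.
have S1 : ubound S 1.
  move=> b Sb; rewrite leNgt; apply/negP => b1.
  have [|N0 HN] := Sb ((b - 1) / 2); first by lra.
  have [A Abox cA] := box_ex r N0.+1.
  have [|d _] := HN N0.+1 (leqnSn _) A Abox.
    by rewrite cA natrX ler_piMl// exprn_ge0.
  move=> /le_trans/(_ (copies_le R A d P0)).
  rewrite lee_fin cA natrX ger_pMl ?exprn_gt0 ?ltr0n//; lra.
have hS : has_sup S by split; [exists 0|exists 1].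
apply: (@xgetPex _ 0 [set b | S b /\ ubound S b]).
exists (sup S); split; last by move=> x Sx; apply: ub_le_sup => //; exists 1.
move=> eps eps0.
have [b Sb supb] := @sup_adherent _ S (eps / 2) (divr_gt0 eps0 (ltr0Sn _ 1)) hS.
have [|N0 HN] := Sb (eps / 2); first exact: divr_gt0.
exists N0 => N N0N A Abox cA; have [d d0 le_d] := HN N N0N A Abox cA.
exists d => //; apply: le_trans le_d; rewrite lee_fin.
apply: ler_wpM2r; first exact: exprn_ge0.
move: supb; lra.
Qed.

(* Main.v *)
Require Import Defs.
From mathcomp Require Import all_boot all_order all_algebra finmap.
From mathcomp Require Import zify ring lra.
From mathcomp Require Import all_classical all_reals all_analysis.

Import Order.TTheory GRing.Theory Num.Theory.

Local Open Scope classical_set_scope.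
Local Open Scope ring_scope.

(** Write phi as x |-> (x M + b) / q with q, M and b integral. Given A in [N]^r,
let A' be the translated image under M of the points of A in one popular
residue class modulo m, where m is a nonzero coordinate of a difference p - p'
of two points of P. A copy of Q in A' with difference d' gives points x, x' of A
with d' (p - p') = q (x - x'); as m divides x - x', this forces q to divide d',
and pulling back along M yields a copy of P in A with difference d' / q. The box
of A' has side at most C N, so A' has density at least a constant times that of
A. When P is a single point, its copies in A are counted by the points of A for
any d. *)

(** * Denominators, pigeonhole and counting *)

Lemma common_denominator (m n : nat) (A : 'M[rat]_(m, n)) :
  exists (q : int) (B : 'M[int]_(m, n)),
    q != 0 /\ q%:~R *: A = map_mx intr B.
Proof.
pose q : int := \prod_(ij : 'I_m * 'I_n) denq (A ij.1 ij.2).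
pose B := \matrix_(i, j) (numq (A i j) *
  \prod_(ij : 'I_m * 'I_n | ij != (i, j)) denq (A ij.1 ij.2)).
exists q, B; split; first by apply/prodf_neq0 => ij _; exact: denq_neq0.
apply/matrixP => i j; rewrite !mxE /q (bigD1 (i, j))//= !intrM.
rewrite -{2}[A i j]divq_num_den; field.
by rewrite intr_eq0 denq_neq0.
Qed.

Lemma pigeonhole_fset (T : choiceType) (J : finType) (j0 : J) (f : T -> J)
    (A : {fset T}) :
  exists j, (#|` A| <= #|J| * #|` [fset x in A | f x == j]%fset|)%N.
Proof.
have cardE : #|` A| = (\sum_j #|` [fset x in A | f x == j]%fset|)%N.
  rewrite card_fset_sum1 (partition_big f predT)//=; apply: eq_bigr => j _.
  by rewrite card_fset_sum1 big_fset_condE.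
have [//|j _ max_j] :=
  @arg_maxnP _ j0 predT (fun j => #|` [fset x in A | f x == j]%fset|).
exists j; rewrite cardE -sum_nat_const; apply: leq_sum => i _.
exact: max_j.
Qed.

Lemma le_counting_image (R : realType) (T U : choiceType) (f : T -> U)
    (S : set U) (X : set T) :
  S `<=` f @` X -> (counting S <= (counting X : \bar R))%E.
Proof.
move=> SfX; rewrite /counting; case: asboolP => [finS|infS];
  case: asboolP => [finX|infX]; rewrite ?leey//; last first.
  by exfalso; apply: infS; apply: sub_finite_set SfX (finite_image _ finX).
rewrite lee_fin ler_nat.
apply: (@leq_trans #|` [fset f x | x in fset_set X]%fset|).
  apply/fsubset_leq_card/fsubsetP => y; rewrite in_fset_set// inE.
  move=> /SfX[x Xx <-]; apply/imfsetP; exists x => //=.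
  by rewrite in_fset_set// inE.
exact: leq_imfset_card.
Qed.

(** * Residue classes and integral matrices *)

Definition residue (r m : nat) (x : 'rV[int]_r) : 'rV['I_m.+1]_r :=
  map_mx (fun a => inord `|(a %% m.+1)%Z|%N) x.
Arguments residue {r} m x.

Lemma residue_dvd (r m : nat) (x y : 'rV[int]_r) (i : 'I_r) :
  residue m x = residue m y -> (m.+1 %| (x 0 i - y 0 i)%R)%Z.
Proof.
move=> /matrixP/(_ 0 i); rewrite !mxE => /(congr1 val) /=.
rewrite !inordK; try by rewrite -ltz_nat gez0_abs ?modz_ge0// ltz_pmod.
by move=> e; rewrite -eqz_mod_dvd; lia.
Qed.

(** Summing over all columns [k], although only column [j] enters, makes the bound independent of
    the coordinate. *)
Lemma mulmx_box (r N : nat) (M : 'M[int]_r) (x : 'rV[int]_r) (j : 'I_r) :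
  in_box N x ->
  `|(x *m M) 0 j| <= (\sum_i \sum_k `|M i k|%N * N)%N%:Z.
Proof.
move=> xbox; rewrite mxE; apply: le_trans (ler_norm_sum _ _ _) _.
rewrite -natz natr_sum; apply: ler_sum => i _; rewrite normrM natz.
rewrite (bigD1 j)//=.
have [x1 xN] := xbox i; have xabs : `|x 0 i| <= N by lia.
set T := (\sum_(k | _) _)%N; nia.
Qed.

Lemma mulmx_int_inj (r : nat) (M : 'M[int]_r) :
  map_mx intr M \in (@unitmx rat r) ->
  injective (fun x : 'rV[int]_r => x *m M).
Proof.
move=> uM x y /(congr1 (map_mx (intr : int -> rat))).
rewrite !map_mxM => /(can_inj (mulmxK uM))/matrixP e.
by apply/matrixP => i j; have := e i j; rewrite !mxE => /intr_inj.
Qed.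

(** Two distinct points differ in some coordinate; the absolute difference [m.+1] becomes the
    modulus of the residue classes. *)
Lemma difference_coordinate (r : nat) (P : {fset 'rV[int]_r}) :
  (exists m : nat, exists p p' i,
     [/\ p \in P, p' \in P & absz ((p - p') 0 i)%R = m.+1])
  \/ {in P &, forall p p', p = p'}.
Proof.
have [|h] := pselect (exists m : nat, exists p p' i,
     [/\ p \in P, p' \in P & absz ((p - p') 0 i)%R = m.+1]); first by left.
right=> p p' pP p'P; apply/matrixP => j i; rewrite (ord1 j).
apply/eqP; rewrite -subr_eq0; apply/negPn/negP => ne; apply: h.
exists (absz ((p - p') 0 i)%R).-1, p, p', i; split=> //.
by rewrite prednK// absz_gt0 !mxE.
Qed.

(** * Transfer of a set along an affine map *)

Section Transfer.
Variables (R : realType) (r : nat) (P Q : {fset 'rV[int]_r}).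
Variables (q : int) (M : 'M[int]_r) (b : 'rV[int]_r).
Hypothesis M_inj : injective (fun x : 'rV[int]_r => x *m M).
Hypothesis PQ : forall p, p \in P -> exists2 y, y \in Q & q *: y = p *m M + b.

(** If [q *: y = p *m M + b] and z + q d y = x M + s, then z = (x - d p) M + s - d b. By [M_inj] the
    point x - d p is the same for every p, so it is the base point of a copy of P in A. *)
Lemma copies_pullback (A A' : {fset 'rV[int]_r}) (s : 'rV[int]_r) (d : int) :
  P != fset0 ->
  (forall z, z \in A' -> exists2 x, x \in A & z = x *m M + s) ->
  (counting (copies Q A' (q * d)) <= (counting (copies P A d) : \bar R))%E.
Proof.
case/fset0Pn=> p0 p0P A'A.
apply: (@le_counting_image _ _ _ (fun x => x *m M + s - d *: b)) => z zQ.
have zP p : p \in P -> exists2 x, x \in A & z = (x - d *: p) *m M + s - d *: b.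
  move=> /PQ[y /zQ/A'A[x xA zx] qy]; exists x => //.
  have -> : z = x *m M + s - d *: (q *: y) by rewrite scalerA mulrC -zx addrK.
  by rewrite qy mulmxBl -scalemxAl scalerDr opprD !addrA [x *m M + s - _]addrAC.
have [x0 x0A zx0] := zP _ p0P.
exists (x0 - d *: p0) => // p pP.
have [x xA zx] := zP _ pP.
move: zx0; rewrite zx => /addIr/addIr/M_inj <-.
by rewrite subrK.
Qed.

Lemma divides_difference (A A' : {fset 'rV[int]_r}) (s p p' : 'rV[int]_r)
    (i : 'I_r) (m : nat) (d : int) :
  p \in P -> p' \in P -> absz ((p - p') 0 i)%R = m.+1 ->
  (forall z, z \in A' -> exists2 x, x \in A & z = x *m M + s) ->
  (forall x y, x \in A -> y \in A -> residue m x = residue m y) ->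
  copies Q A' d !=set0 -> (q %| d)%Z.
Proof.
move=> /PQ[y yQ qy] /PQ[y' y'Q qy'] mE A'A resA [z zQ].
have [x xA zx] := A'A _ (zQ _ yQ); have [x' x'A zx'] := A'A _ (zQ _ y'Q).
(* Both sides equal [(q * d) *: (y - y')]. *)
have : (d *: (p - p')) *m M = (q *: (x - x')) *m M.
  rewrite -!scalemxAl.
  have -> : (p - p') *m M = q *: (y - y').
    by rewrite scalerBr qy qy' mulmxBl opprD addrACA subrr addr0.
  have -> : (x - x') *m M = d *: (y - y').
    rewrite mulmxBl scalerBr; apply/eqP; rewrite subr_eq.
    have -> : x *m M = z + d *: y - s by rewrite zx addrK.
    have -> : x' *m M = z + d *: y' - s by rewrite zx' addrK.
    by apply/eqP/matrixP => a c; rewrite !mxE; ring.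
  by rewrite !scalerA mulrC.
move=> /M_inj/matrixP/(_ 0 i) e.
have /dvdzP[t xt] : (m.+1 %| (x 0 i - x' 0 i)%R)%Z by exact/residue_dvd/resA.
(* [mE] determines the coordinate of p - p' up to sign, and u absorbs the sign. Cancelling this
   coordinate leaves d = t u q. *)
have /dvdzP[u mu] : (((p - p') 0 i)%R %| m.+1%:Z)%Z by rewrite dvdzE mE.
have pp0 : (p - p') 0 i != 0 by rewrite -absz_gt0 mE.
rewrite -(dvdz_mul2r pp0); apply/dvdzP.
exists (t * u); move: e; rewrite !mxE in mu xt *; rewrite xt mu.
by move=> ->; ring.
Qed.

(** [C] is the growth of the box and [D] the density lost to residue classes. Both are fixed before
    [N] and [A], and one [A'] serves every [d']. *)
Lemma affine_transfer : P != fset0 -> exists C D : nat,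
  [/\ (0 < C)%N, (0 < D)%N &
   forall (N : nat) (A : {fset 'rV[int]_r}),
     (forall x, x \in A -> in_box N x) ->
     exists A' : {fset 'rV[int]_r},
     [/\ forall z, z \in A' -> in_box (C * N) z,
         (#|` A| <= D * #|` A'|)%N &
         forall d' : int, d' != 0 -> exists2 d : int, d != 0 &
           (counting (copies Q A' d') <= (counting (copies P A d) : \bar R))%E]].
Proof.
move=> P0.
have Q0 : Q != fset0.
  by have /fset0Pn[p /PQ[y yQ _]] := P0; apply/fset0Pn; exists y.
pose K := (\sum_i \sum_k `|M i k|)%N.
have [m Hm] : exists m : nat, (exists p p' i,
     [/\ p \in P, p' \in P & absz ((p - p') 0 i)%R = m.+1])
  \/ {in P &, forall p p', p = p'}.
  case: (difference_coordinate r P) => [[m h]|h]; first by exists m; left.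
  by exists 0%N; right.
(* Coordinates of x M lie in [-KN, KN]; the shift by KN + 1 moves them to [1, 2KN + 1]. [D] is the
   number of residue classes. *)
exists (2 * K).+1, #|{: 'rV['I_m.+1]_r}|; split=> //.
  by apply/card_gt0P; exists (const_mx ord0).
move=> N A Abox.
have [j cA] := pigeonhole_fset _ _ (const_mx ord0) (residue m) A.
pose Aj := [fset x in A | residue m x == j]%fset.
pose s : 'rV[int]_r := const_mx (K * N).+1%:Z.
pose f (x : 'rV[int]_r) := x *m M + s.
have f_inj : injective f by move=> x y /addIr/M_inj.
pose A' := [fset f x | x in Aj]%fset.
have cA' : #|` A'| = #|` Aj| by rewrite card_imfset.
have AjA : {subset Aj <= A} by move=> x; rewrite !inE => /andP[].
have A'A z : z \in A' -> exists2 x, x \in Aj & z = x *m M + s.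
  by move=> /imfsetP[x xA ->]; exists x.
have le_copies d :
    (counting (copies P Aj d) <= (counting (copies P A d) : \bar R))%E.
  apply: (@le_counting_image _ _ _ id) => x xP; exists x => // p pP.
  exact/AjA/xP.
exists A'; split; rewrite ?cA'//.
- move=> z /A'A[x /AjA/Abox xbox ->] i.
  have := mulmx_box r N M x i xbox; have [x1 xN] := xbox i; rewrite !mxE.
  have -> : (\sum_i \sum_k `|M i k| * N = K * N)%N.
    by rewrite big_distrl; apply: eq_bigr => ? _; rewrite big_distrl.
  (* N >= 1 because the box contains a point with a coordinate [i]; hence 2KN + 1 <= (2K + 1)N. *)
  have : (0 < N)%N by lia.
  lia.
- move=> d' d'0; case: Hm => [[p [p' [i [pP p'P mE]]]]|Psing]; last first.
    exists 1 => //; apply: le_trans (le_copies 1).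
    apply: le_trans (copies_le R A' d' Q0) _.
    have /fset0Pn[p pP] := P0.
    have -> : ((#|` A'|%:R : R)%:E = counting [set` A'])%E.
      by rewrite /counting asboolT ?set_fsetK.
    apply: (@le_counting_image _ _ _ (fun x => f (x + p))) => z /= /A'A[x xA ->].
    exists (x - p); last by rewrite /f subrK.
    by move=> y yP; rewrite (Psing _ _ yP pP) scale1r subrK.
  (* Divisibility of d' needs an actual copy of Q; without one, any nonzero d will do. *)
  have [copies0|ne] := pselect (copies Q A' d' = set0).
    exists 1 => //; rewrite copies0; apply: (@le_counting_image _ _ _ id) => //.
  have /dvdzP[d dE] : (q %| d')%Z.
    apply: (divides_difference Aj A' s p p' i m) => //.
      by move=> x y; rewrite !inE => /andP[_ /eqP->] /andP[_ /eqP->].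
    exact/set0P/eqP.
  exists d; first by apply: contraNneq d'0 => d0; rewrite dE d0 mul0r.
  apply: le_trans (le_copies d); rewrite dE mulrC.
  exact: (copies_pullback _ _ s).
Qed.

End Transfer.

(** * The empty pattern *)

Lemma popular_fset0_sub (R : realType) (r : nat) (a b : R) : a <= 1 ->
  popular (fset0 : {fset 'rV[int]_r}) a `<=`
  popular (fset0 : {fset 'rV[int]_r}) b.
Proof.
move=> a1 x ax eps /ax[N0 HN]; exists N0 => N N0N A _ _.
(* The copies of the empty pattern fill the whole space for every set and every d, so the bound for
   one admissible set, the full box, carries over to A. *)
have [B Bbox cB] := box_ex r N.
have [|d d0 le_d] := HN N N0N B Bbox.
  by rewrite cB natrX ler_piMl// exprn_ge0.
exists d => //; apply: le_trans le_d _.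
by apply: (le_counting_image _ _ _ id) => z _; exists z.
Qed.

(** A largest element may fail to exist here, so the two [popular] sets are compared instead: equal
    sets give equal values, default or not. *)
Lemma pdd_fset0 (R : realType) (r : nat) (a b : R) : a <= 1 -> b <= 1 ->
  pdd (fset0 : {fset 'rV[int]_r}) a = pdd (fset0 : {fset 'rV[int]_r}) b.
Proof.
move=> a1 b1; rewrite /pdd.
suff -> : popular (fset0 : {fset 'rV[int]_r}) a =
          popular (fset0 : {fset 'rV[int]_r}) b by [].
by apply/seteqP; split; exact: popular_fset0_sub.
Qed.

(** * Comparison of the densities *)

Theorem proposition2p2 (R : realType) (r : nat) (P Q : {fset 'rV[int]_r})
    (hPQ : exists phi : 'rV[rat]_r -> 'rV[rat]_r,
       invertible_affine phi /\
       phi @` (@rat_vec r @` [set` P]) = @rat_vec r @` [set` Q]) :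
  exists c : R, (0 < c /\ c < 1) /\
    forall alpha : R, 0 < alpha -> alpha < 1 ->
      pdd Q (c * alpha) <= pdd P alpha.
Proof.
case: hPQ => phi [[M [b [uM phiE]]] imPQ].
have PQ p : p \in P -> exists2 y, y \in Q & rat_vec y = phi (rat_vec p).
  move=> pP.
  have [y yQ e] : (@rat_vec r @` [set` Q]) (phi (rat_vec p)).
    by rewrite -imPQ; exists (rat_vec p) => //; exists p.
  by exists y.
have [P0|P0] := eqVneq P fset0.
  have Q0 : Q = fset0.
    apply/eqP; apply: contraT => /fset0Pn[y yQ].
    have : (@rat_vec r @` [set` Q]) (rat_vec y) by exists y.
    by rewrite -imPQ => -[_ [p /= pP _] _]; rewrite P0 inE in pP.
  exists 2^-1; split; first by split; lra.
  by move=> alpha alpha0 alpha1; rewrite P0 Q0 (@pdd_fset0 _ _ _ alpha)//; lra.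
have Q0 : Q != fset0.
  by have /fset0Pn[p /PQ[y yQ _]] := P0; apply/fset0Pn; exists y.
(* Stacking M on b yields one denominator q for both. *)
have [q [B [q0 qB]]] := common_denominator _ _ (col_mx M b).
pose M' := usubmx B; pose b' := dsubmx B.
have [qM qb] : q%:~R *: M = map_mx intr M' /\ q%:~R *: b = map_mx intr b'.
  apply: eq_col_mx; rewrite -scale_col_mx qB -map_col_mx.
  by rewrite vsubmxK.
have M'_inj : injective (fun x : 'rV[int]_r => x *m M').
  apply: mulmx_int_inj; rewrite -qM unitmxZ// unitfE intr_eq0//.
have PQ' p : p \in P -> exists2 y, y \in Q & q *: y = p *m M' + b'.
  move=> /PQ[y yQ yp]; exists y => //.
  have e : map_mx (intr : int -> rat) (q *: y) = map_mx intr (p *m M' + b').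
    rewrite map_mxZ map_mxD map_mxM -qM -qb -scalemxAr -scalerDr.
    by rewrite -[map_mx _ y]/(rat_vec y) yp phiE.
  by apply/matrixP => i j; move/matrixP/(_ i j): e; rewrite !mxE => /intr_inj.
have [C [D [C0 D0 H]]] := @affine_transfer R r P Q q M' b' M'_inj PQ' P0.
have E1 : 1 <= D%:R * C%:R ^+ r :> R.
  by rewrite -natrX -natrM -[1]/(1%:R) ler_nat muln_gt0 D0 expn_gt0 C0.
set E := D%:R * C%:R ^+ r in E1.
have c1 : (2 * E)^-1 <= 2^-1 by rewrite lef_pV2 ?posrE; lra.
have c0 : 0 < (2 * E)^-1 by rewrite invr_gt0; lra.
(* A' has density at least alpha / E in the box of side C N; as only E >= 1 is known, the factor 2
   ensures c < 1. *)
exists (2 * E)^-1; split; first by split; lra.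
move=> alpha alpha0 alpha1.
have [|popQ _] := pddP Q0 (_ : (2 * E)^-1 * alpha <= 1); first by nra.
have [_ ubP] := pddP P0 (ltW alpha1); apply: ubP => eps eps0.
have [N0 HN] := popQ _ eps0.
exists N0 => N N0N A Abox cA.
have [A' [A'box cA' HA']] := H N A Abox.
have [||d' d'0 le_d'] := HN (C * N)%N _ A' A'box.
- by apply: leq_trans N0N _; rewrite leq_pmull.
- have cA'R : #|` A|%:R <= D%:R * #|` A'|%:R :> R by rewrite -natrM ler_nat.
  have D0R : 0 < D%:R :> R by rewrite ltr0n.
  have C0R : 0 < C%:R ^+ r :> R by rewrite exprn_gt0 ?ltr0n.
  rewrite natrM exprMn -(ler_pM2l D0R); apply: le_trans cA'R.
  apply: le_trans cA.
  have -> : D%:R * ((2 * E)^-1 * alpha * (C%:R ^+ r * N%:R ^+ r)) =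
      2^-1 * (alpha * N%:R ^+ r).
    by rewrite /E; field; rewrite !gt_eqF.
  have : 0 <= alpha * N%:R ^+ r by rewrite mulr_ge0 ?exprn_ge0// ltW.
  lra.
have [d d0 le_d] := HA' _ d'0; exists d => //; apply: le_trans le_d.
(* Passing from (C N)^r down to N^r weakens the bound only when its coefficient is nonnegative;
   otherwise the claim is trivial. *)
have [neg|pos] := leP (pdd Q ((2 * E)^-1 * alpha) - eps) 0.
  apply: (@le_trans _ _ 0%E).
    by rewrite lee_fin mulr_le0_ge0 ?exprn_ge0.
  by rewrite /counting; case: ifPn; rewrite ?lee_fin ?leey.
apply: le_trans le_d'; rewrite lee_fin ler_pM2l//.
by rewrite lerXn2r ?nnegrE// ler_nat leq_pmull.
Qed.
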